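(* For each $k\in\mathbb{N}$, the sequence $(s_{k,n})_{n=1}^\infty$, where $s_{k,n}=|(k\mathcal{S})^n|$, satisfies the linear recurrence with characteristic polynomial $p_k(x)$.
   Context: $\mathbb{N}$ denotes the set of positive integers. A set $F\subseteq\mathbb{N}$ is a Schreier set if it is non-empty and $|F|\leq\min F$. For $k\in\mathbb{N}$, $k\mathcal{S}$ is the collection of all subsets of $\mathbb{N}$ that can be written as a union of at most $k$ Schreier sets, and for $n\in\mathbb{N}$, $(k\mathcal{S})^n$ is the collection of all $F\in k\mathcal{S}$ with $\max F=n$. A sequence $(a_n)_{n=1}^\infty$ satisfies the linear recurrence with characteristic polynomial $p(x)=c_mx^m+c_{m-1}x^{m-1}+\dots+c_1x+c_0$ (with $c_m\neq 0$) if $c_ma_{n+m}+c_{m-1}a_{n+m-1}+\dots+c_1a_{n+1}+c_0a_n=0$ for every $n\in\mathbb{N}$. The polynomials $p_k$ are defined by $p_0(x)=x-1$ and $p_{k+1}(x)=p_k(x(x-1))$ for every integer $k\geq 0$; $p_k$ has degree $2^k$. *)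

(* Defs.v *)
From HB Require Import structures.
From mathcomp Require Import all_boot all_order all_algebra finmap.
From mathcomp Require Import boolp classical_sets cardinality.

Set Implicit Arguments.
Unset Strict Implicit.
Unset Printing Implicit Defensive.

Import Order.TTheory GRing.Theory Num.Theory.

Local Open Scope fset_scope.
Local Open Scope classical_set_scope.
Local Open Scope ring_scope.

(** Finite sets of naturals model the finite subsets of {1, 2, ...}. *)

(* The maximum, with value 0 on the empty set. *)
Definition fmax (F : {fset nat}) : nat := (\max_(i <- F) i)%N.

(* The minimum, with value 0 on the empty set. *)
Definition fmin (F : {fset nat}) : nat := (\big[minn/fmax F]_(i <- F) i)%N.

Lemma fminP (F : {fset nat}) :
  F != fset0 -> fmin F \in F /\ forall i, i \in F -> (fmin F <= i)%N.
Proof.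
move=> F0.
have FP (r : seq nat) (x : nat) : \big[minn/x]_(i <- r) i \in x :: r /\
    forall i, i \in r -> (\big[minn/x]_(i <- r) i <= i)%N.
  elim: r => [|y r [IH1 IH2]]; first by rewrite big_nil inE.
  rewrite big_cons; split=> [|i].
    rewrite /minn; case: ifP => _; first by rewrite !inE eqxx orbT.
    by move: IH1; rewrite !inE => /orP[->//|->]; rewrite !orbT.
  by rewrite inE geq_min => /orP[/eqP->|/IH2->]; rewrite ?leqnn ?orbT.
have maxF : fmax F \in F.
  have MP (r : seq nat) : r != [::] -> (\max_(i <- r) i)%N \in r.
    elim: r => // y [|z r] IH _; first by rewrite big_cons big_nil maxn0 inE.
    rewrite big_cons /maxn; case: ifP => _; last by rewrite inE eqxx.
    by rewrite inE IH ?orbT.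
  by apply: MP; apply: contra F0 => /eqP F0; rewrite -cardfs_eq0 F0.
have [H1 H2] := FP F (fmax F); split; last exact: H2.
by move: H1; rewrite inE => /orP[/eqP H|//]; rewrite /fmin H.
Qed.

(* There is no need to ask that 0 is not in [F]: a nonempty [F] has
   [0 < #|` F|], so the bound excludes it. *)
Definition schreier (F : {fset nat}) : Prop :=
  F != fset0 /\ (#|` F| <= fmin F)%N.

Definition kS (k : nat) : set {fset nat} :=
  [set F | exists s : seq {fset nat},
    [/\ (size s <= k)%N, (forall G, G \in s -> schreier G)
      & F = \bigcup_(G <- s) G]].

Definition kS_max (k n : nat) : set {fset nat} :=
  [set F | kS k F /\ fmax F = n].

Lemma kS_max_finite (k n : nat) : finite_set (kS_max k n).
Proof.
apply: (@sub_finite_set _ _ [set` fpowerset [fset i in iota 0 n.+1]]).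
  move=> F [_ Fn] /=; rewrite fpowersetE; apply/fsubsetP => i iF.
  have le_in : (i <= n)%N by rewrite -Fn; apply: (leq_bigmax_seq (F := id)).
  by rewrite !inE /= mem_iota add1n ltnS le_in lt0n andbT orbN.
exact: finite_fset.
Qed.

(* [fset_set] is the empty set on infinite sets; [kS_max_finite] shows that
   this case does not occur here. *)
Definition schreier_count (k n : nat) : nat := #|` fset_set (kS_max k n)|.

(* The coefficients c_0, ..., c_m of the characteristic polynomial are
   [p`_0, ..., p`_(size p).-1], so that c_m is [lead_coef p]; sequences are
   indexed by the positive integers, hence [0 < n]. *)
Definition linear_recurrence (R : nzRingType) (p : {poly R}) (a : nat -> R) :
    Prop :=
  p != 0 /\
  forall n : nat, (0 < n)%N -> \sum_(i < size p) p`_i * a (n + i)%N = 0.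

Fixpoint schreier_poly (k : nat) : {poly int} :=
  if k is k'.+1 then schreier_poly k' \Po ('X * ('X - 1)) else 'X - 1.

Lemma size_schreier_poly (k : nat) : size (schreier_poly k) = (2 ^ k).+1.
Proof.
elim: k => [|k IH] /=; first by rewrite -polyC1 size_XsubC.
have sq : size ('X * ('X - 1) : {poly int}) = 3.
  by rewrite -polyC1 mulrC size_mulX ?size_XsubC // -size_poly_eq0 size_XsubC.
have := size_comp_poly (schreier_poly k) ('X * ('X - 1)).
rewrite sq IH /= expnSr => H.
have : (0 < size (schreier_poly k \Po ('X * ('X - 1))))%N.
  by rewrite lt0n size_poly_eq0 comp_poly_eq0 ?sq // -size_poly_eq0 IH.
by move=> /prednK <-; rewrite H.
Qed.

(* Main.v *)
(* Read an increasing list from left to right, filling Schreier sets greedily,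
   and let N k r i n count the lists in (i, n] ending in n that are accepted
   when r places are left in the current set and k further sets may be opened.
   Let Q_0 = x, Q_(k+1) = Q_k (Q_k - 1), so that p_k = Q_k - 1, and let E be the
   shift in the variable n. By induction on k,
     Q_k(E) N_k(r, i) = N_k(r, i - 1)  for 1 <= i <= n;
   since N_k(r + 1, i - 1) - N_k(r + 1, i) = N_k(r, i), this implies
     Q_(k+1)(E) N_k(r + 1, i) = N_k(r, i - 1),
   and descending induction on i then gives the first identity for k + 1. In the
   base case i = n every list is accepted, so that the sequence is geometric
   with ratio 2, which is a fixed point of x (x - 1). Finally
   s_k = N_k(0, 0) = N_k(0, 1) + N_(k-1)(0, 1); here Q_k(E) maps the first
   summand to s_k, and annihilates the second one because Q_(k-1)(E) maps it
   to s_(k-1). *)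

Require Import Defs.
From mathcomp Require Import all_boot all_order all_algebra.
From mathcomp Require Import finmap boolp classical_sets cardinality zify ring.

Set Implicit Arguments.
Unset Strict Implicit.
Unset Printing Implicit Defensive.

Import GRing.Theory.
Local Open Scope ring_scope.

(** * Polynomials in the shift *)

Definition shift_poly (p : {poly int}) (a : nat -> int) (n : nat) : int :=
  \sum_(i < size p) p`_i * a (n + i)%N.

Lemma shift_poly_wide (m : nat) (p : {poly int}) (a : nat -> int) (n : nat) :
  (size p <= m)%N -> shift_poly p a n = \sum_(i < m) p`_i * a (n + i)%N.
Proof.
move=> le_pm; rewrite /shift_poly (big_ord_widen m (fun i => p`_i * a (n + i)%N)) //.
rewrite big_mkcond; apply: eq_bigr => i _; case: ltnP => // le_pi.
by rewrite nth_default // mul0r.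
Qed.

Lemma shift_polyD (p q : {poly int}) (a : nat -> int) (n : nat) :
  shift_poly (p + q) a n = shift_poly p a n + shift_poly q a n.
Proof.
pose m := maxn (size p) (size q).
rewrite !(@shift_poly_wide m) ?leq_maxl ?leq_maxr ?size_polyD // -big_split.
by apply: eq_bigr => i _; rewrite coefD mulrDl.
Qed.

Lemma shift_polyZ (c : int) (p : {poly int}) (a : nat -> int) (n : nat) :
  shift_poly (c *: p) a n = c * shift_poly p a n.
Proof.
rewrite (@shift_poly_wide (size p)) ?size_scale_leq // mulr_sumr.
by apply: eq_bigr => i _; rewrite coefZ mulrA.
Qed.

Lemma shift_polyMX (p : {poly int}) (a : nat -> int) (n : nat) :
  shift_poly (p * 'X) a n = shift_poly p a n.+1.
Proof.
rewrite (@shift_poly_wide (size p).+1).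
  rewrite big_ord_recl coefMX mul0r add0r.
  by apply: eq_bigr => i _; rewrite coefMX /= addSnnS.
by rewrite (leq_trans (size_polyMleq _ _)) // size_polyX addn2.
Qed.

Lemma shift_poly0 (a : nat -> int) (n : nat) : shift_poly 0 a n = 0.
Proof. by rewrite /shift_poly size_poly0 big_ord0. Qed.

Lemma shift_poly1 (a : nat -> int) (n : nat) : shift_poly 1 a n = a n.
Proof. by rewrite /shift_poly size_poly1 big_ord1 coef1 mul1r addn0. Qed.

Lemma shift_polyM (p q : {poly int}) (a : nat -> int) (n : nat) :
  shift_poly (p * q) a n = shift_poly p (shift_poly q a) n.
Proof.
elim/poly_ind: p n => [|p c IH] n; first by rewrite mul0r !shift_poly0.
rewrite mulrDl -mulrA (mulrC 'X) mulrA mul_polyC !shift_polyD shift_polyMX.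
by rewrite shift_polyMX IH shift_polyZ -[c%:P]alg_polyC shift_polyZ shift_poly1.
Qed.

(** The operator Q_k(E), given without coefficients so that linearity and dependence on few values
    follow by induction on [k]. *)
Fixpoint shift_iter (k : nat) (a : nat -> int) (n : nat) : int :=
  if k is k'.+1 then shift_iter k' (fun m => shift_iter k' a m - a m) n
  else a n.+1.

Fixpoint iter_poly (k : nat) : {poly int} :=
  if k is k'.+1 then iter_poly k' * (iter_poly k' - 1) else 'X.

(** Q_k is the [k]-fold iterate of x (x - 1); one factor can be peeled off outside, as in
    [iter_poly], or inside, as in [schreier_poly]. *)
Lemma iter_polyS (k : nat) :
  iter_poly k.+1 = iter_poly k \Po ('X * ('X - 1)).
Proof.
elim: k => [|k IH]; first by rewrite /= comp_polyX.
by rewrite [in RHS]/= comp_polyM comp_polyB -polyC1 comp_polyC -IH.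
Qed.

Lemma schreier_poly_iter (k : nat) : schreier_poly k = iter_poly k - 1.
Proof.
elim: k => // k IH; rewrite iter_polyS /= IH.
by rewrite comp_polyB -polyC1 comp_polyC.
Qed.

Lemma shift_poly_iter (k : nat) (a : nat -> int) (n : nat) :
  shift_poly (iter_poly k) a n = shift_iter k a n.
Proof.
elim: k a n => [|k IH] a n /=.
  by rewrite -['X]mul1r shift_polyMX shift_poly1.
rewrite shift_polyM IH; congr shift_iter; apply: funext => m.
by rewrite shift_polyD IH -scaleN1r shift_polyZ shift_poly1 mulN1r.
Qed.

(** Q_k is divisible by x and has degree 2^k. *)
Lemma shift_iter_local (k : nat) (a b : nat -> int) (n : nat) :
  (forall m, (n < m <= n + 2 ^ k)%N -> a m = b m) ->
  shift_iter k a n = shift_iter k b n.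
Proof.
elim: k a b n => [|k IH] a b n eq_ab /=; first by apply: eq_ab; lia.
rewrite expnS in eq_ab; apply: (IH) => m Hm; rewrite (IH a b) ?eq_ab //; first by lia.
by move=> p Hp; apply: eq_ab; lia.
Qed.

Lemma shift_iter_eq (k : nat) (a b : nat -> int) (n : nat) :
  (forall m, (n < m)%N -> a m = b m) -> shift_iter k a n = shift_iter k b n.
Proof. by move=> eq_ab; apply: shift_iter_local => m /andP[/eq_ab]. Qed.

Lemma shift_iterD (k : nat) (a b : nat -> int) (n : nat) :
  shift_iter k (fun m => a m + b m) n = shift_iter k a n + shift_iter k b n.
Proof.
elim: k a b n => //= k IH a b n; rewrite -IH; apply: shift_iter_eq => m _.
by rewrite IH opprD addrACA.
Qed.

Lemma shift_iterN (k : nat) (a : nat -> int) (n : nat) :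
  shift_iter k (fun m => - a m) n = - shift_iter k a n.
Proof.
elim: k a n => //= k IH a n; rewrite -IH; apply: shift_iter_eq => m _.
by rewrite IH opprD.
Qed.

(** As x (x - 1) fixes 2, Q_k(2) = 2 and Q_k(E) doubles powers of 2. Only [m > n >= i] matter, so
    [m - i.+1] is never truncated. *)
Lemma shift_iter_exp2 (k i n : nat) : (i <= n)%N ->
  shift_iter k (fun m => 2 ^+ (m - i.+1)) n = 2 ^+ (n - i).
Proof.
elim: k n => [|k IH] n le_in //=.
rewrite -[RHS]IH //; apply: shift_iter_eq => m lt_nm.
have lt_im := leq_ltn_trans le_in lt_nm.
by rewrite IH 1?ltnW // subnS -{1}(prednK (n := m - i)) ?subn_gt0 // exprS; ring.
Qed.

(** * Counting the lists accepted by the greedy algorithm *)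

(** An element [x] that opens a set is its minimum, so [x.-1] more fit. *)
Fixpoint greedy (k r : nat) (s : seq nat) : bool :=
  if s is x :: s' then
    match r, k with
    | r'.+1, _ => greedy k r' s'
    | 0, k'.+1 => greedy k' x.-1 s'
    | 0, 0 => false
    end
  else true.

(* The increasing lists with entries in (i, i + d + 1] and last entry
   i + d + 1. *)
Fixpoint increasing (d i : nat) : seq (seq nat) :=
  if d is d'.+1 then
    map (cons i.+1) (increasing d' i.+1) ++ increasing d' i.+1
  else [:: [:: i.+1]].

(** For [n <= i] truncated subtraction yields the value at [n = i.+1], hence the hypotheses [i < n]
    below. *)
Definition N (k r i n : nat) : int :=
  (count (greedy k r) (increasing (n - i.+1) i))%:Z.

Lemma NS (k r i n : nat) : (i.+1 < n)%N ->
  N k r.+1 i n = N k r.+1 i.+1 n + N k r i.+1 n.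
Proof.
move=> lt_in; rewrite /N -(prednK (n := n - i.+1)) ?subn_gt0 //= -subnS.
by rewrite count_cat count_map PoszD addrC.
Qed.

(** As in [NS], split by whether the list starts with [i.+1]; here that entry opens a set and leaves
    [i] places. *)
Lemma N0S (k i n : nat) : (i.+1 < n)%N ->
  N k.+1 0 i n = N k.+1 0 i.+1 n + N k i i.+1 n.
Proof.
move=> lt_in; rewrite /N -(prednK (n := n - i.+1)) ?subn_gt0 //= -subnS.
by rewrite count_cat count_map PoszD addrC.
Qed.

Lemma N00 (i n : nat) : N 0 0 i n = 0.
Proof.
rewrite /N; move: (n - i.+1)%N => d; elim: d i => //= d IH i.
rewrite count_cat count_map PoszD IH addr0.
by rewrite (eq_count (a2 := pred0)) ?count_pred0.
Qed.

(** With no further set to open, only the length of the list matters. *)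
Lemma N0_shift (r i n : nat) : N 0 r i.+1 n.+1 = N 0 r i n.
Proof.
rewrite /N subSS; congr Posz; move: (n - i.+1)%N => d.
elim: d r i => [|d IH] [|r] i //=; rewrite !count_cat !count_map (IH _ i.+1) //.
  congr addn; rewrite (eq_count (a2 := pred0)) // count_pred0.
  by rewrite (eq_count (a2 := pred0)) // count_pred0.
by rewrite [X in (X + _)%N]IH.
Qed.

(** Even all of (i, n] is accepted: the current set reaches [i + r], and a set opened at m reaches
    2m - 1, so that each new set doubles the bound. *)
Lemma N_full (k r i n : nat) : (i < n)%N -> (n < (i + r).+1 * 2 ^ k)%N ->
  N k r i n = 2 ^+ (n - i.+1).
Proof.
move=> lt_in; have {lt_in} [d ->] : exists d, n = (i + d).+1 by exists (n - i.+1)%N; lia.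
rewrite subSS addKn; elim: d k r i {n} => [|d IH] k r i full.
  rewrite /N addn0 subnn /=; case: r full => //; case: k => // full.
  by move: full; rewrite expn0; lia.
have exp2D (x : int) : x = 2 ^+ d -> x + x = 2 ^+ d.+1 by move=> ->; rewrite exprS; ring.
rewrite -addSnnS in full *; case: r full => [|r] full.
  case: k full => [|k] full; first by move: full; rewrite expn0; lia.
  rewrite N0S; last by lia.
  rewrite !IH ?exp2D //; move: full; rewrite expnS; nia.
rewrite NS; last by lia.
rewrite !IH ?exp2D //; nia.
Qed.

(** For [k > 0] the window (i + 1, i + 1 + 2^k] seen by Q_k(E) lies in the range of [N_full]. *)
Lemma shift_N_diag (k r i : nat) : (0 < k)%N ->
  shift_iter k (N k r i.+1) i.+1 = N k r i i.+1.
Proof.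
move=> k0; have lt_k : (1 < 2 ^ k)%N by rewrite -{1}(expn0 2) ltn_exp2l.
rewrite (@N_full _ _ i i.+1) //; last by nia.
rewrite -(@shift_iter_exp2 k i.+1 i.+1) //.
by apply: shift_iter_local => m /andP[lt_im le_m]; rewrite N_full //; nia.
Qed.

(** One use of the hypothesis turns Q_k(E) - 1 into a difference in [i], which by [NS] lowers [r]; a
    second use lowers [i]. *)
Lemma shift_N_capacity (k : nat) :
  (forall r i n, (i < n)%N -> shift_iter k (N k r i.+1) n = N k r i n) ->
  forall r i n, (i < n)%N -> shift_iter k.+1 (N k r.+1 i.+1) n = N k r i n.
Proof.
move=> shift_N r i n lt_in /=; rewrite -shift_N //.
apply: shift_iter_eq => m lt_nm; have lt_im := leq_ltn_trans lt_in lt_nm.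
by rewrite shift_N 1?ltnW // NS // addrC addKr.
Qed.

Lemma shift_N (k r i n : nat) : (i < n)%N ->
  shift_iter k (N k r i.+1) n = N k r i n.
Proof.
elim: k r i n => [|k IHk] r i n lt_in; first exact: N0_shift.
have {lt_in} [d ->] : exists d, n = (i + d).+1 by exists (n - i.+1)%N; lia.
elim: d r i {n} => [|d IHd] r i; first by rewrite addn0 shift_N_diag.
rewrite -addSnnS; elim: r => [|r IHr].
  rewrite N0S; last by lia.
  (* A set opened at [i.+2] has one place more than one opened at [i.+1]; [shift_N_capacity] absorbs
     this difference. *)
  rewrite -IHd -(shift_N_capacity IHk); last by lia.
  rewrite -shift_iterD; apply: shift_iter_eq => m lt_m; rewrite N0S //; lia.
rewrite NS; last by lia.
rewrite -!IHd -shift_iterD; apply: shift_iter_eq => m lt_m; rewrite NS //; lia.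
Qed.

Lemma shift_N_start (k n : nat) : (0 < n)%N ->
  shift_iter k (N k 0 0) n = N k 0 0 n.
Proof.
elim: k n => [|k IH] n n0; first by rewrite /= !N00.
rewrite (@shift_iter_eq _ _ (fun m => N k.+1 0 1 m + N k 0 1 m)); last first.
  by move=> m lt_nm; rewrite N0S //; lia.
rewrite shift_iterD shift_N // -[RHS]addr0; congr (_ + _) => /=.
(* Q_k(E) maps both [N k 0 1] and its image [N k 0 0] to [N k 0 0], so the difference vanishes. *)
rewrite shift_iterD shift_iterN shift_N // -(IH n n0).
apply/eqP; rewrite subr_eq0; apply/eqP; apply: shift_iter_eq => m lt_nm.
by rewrite shift_N //; lia.
Qed.

(** * Unions of Schreier sets and the greedy algorithm *)

Local Open Scope fset_scope.

Lemma path_ltn_last (x : nat) (s : seq nat) :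
  path ltn x s -> (x + size s <= last x s)%N.
Proof.
elim: s x => [|y s IH] x /=; first by rewrite addn0.
by move=> /andP[lt_xy /IH]; apply: leq_trans; rewrite -addSnnS leq_add2r.
Qed.

Lemma mem_increasing (d i : nat) (s : seq nat) :
  (s \in increasing d i) = path ltn i s && (last i s == (i + d).+1).
Proof.
elim: d i s => [|d IH] i [|x s] /=.
- by rewrite inE addn0 ltn_eqF.
- rewrite inE eqseq_cons addn0; apply/idP/idP.
    by move=> /andP[/eqP-> /eqP->] /=; rewrite ltnSn eqxx.
  move=> /andP[/andP[lt_ix /path_ltn_last le_last] /eqP last_s].
  rewrite last_s in le_last; rewrite -size_eq0; move: lt_ix => /=; lia.
- rewrite mem_cat IH /= addSnnS [(i == _)]ltn_eqF ?ltnS ?leq_addr //.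
  rewrite [(i.+1 == _)]ltn_eqF ?orbF; last by lia.
  by apply/negbTE/mapP => -[].
rewrite mem_cat IH /= addSnnS.
have -> : (x :: s \in map (cons i.+1) (increasing d i.+1)) =
    (x == i.+1) && (s \in increasing d i.+1).
  apply/mapP/andP => [[t t_in [-> ->]]|[/eqP-> s_in]]; first by rewrite eqxx.
  by exists s.
rewrite IH addSnnS; case: (ltngtP x i.+1) => [lt|lt|->] //=.
by rewrite orbF.
Qed.

Lemma increasing_uniq (d i : nat) : uniq (increasing d i).
Proof.
elim: d i => //= d IH i; rewrite cat_uniq map_inj_uniq ?IH => [|s t []] //=.
rewrite andbT; apply/hasPn => s s_in; apply/mapP => -[t _ eq_s].
by move: s_in; rewrite eq_s mem_increasing /= ltnn.
Qed.

(** [s0] is the share of the current set, whose earlier elements are no longer in the list; for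
    [r = 0] it is empty. *)
Lemma greedy_kS (k r i : nat) (s : seq nat) : path ltn i s -> greedy k r s ->
  exists s0 s1, [/\ s = s0 ++ s1, (size s0 <= r)%N & kS k [fset x in s1]].
Proof.
elim: s k r i => [|x s IH] k r i.
  move=> _ _; exists [::], [::]; split=> //; exists [::]; split=> //.
  by rewrite big_nil; apply/fsetP => y; rewrite !inE.
move=> /= /andP[lt_ix path_s].
case: r => [|r]; last first.
  move=> /(IH _ _ _ path_s)[s0 [s1 [-> le_s0 kS_s1]]].
  by exists (x :: s0), s1.
case: k => // k /(IH _ _ _ path_s)[s0 [s1 [eq_s le_s0 [Gs [le_Gs schr eq_s1]]]]].
exists [::], (x :: s); split=> //; exists ([fset y in x :: s0] :: Gs).
split=> //.
  move=> G; rewrite inE => /orP[/eqP->|]; last exact: schr.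
  have neq0 : [fset y in x :: s0] != fset0.
    by apply/fset0Pn; exists x; rewrite !inE eqxx.
  split=> //; have [min_in _] := fminP neq0.
  have le_x : (x <= fmin [fset y in x :: s0])%N.
    move: min_in; rewrite !inE => /orP[/eqP-> //|min_s0]; apply: ltnW.
    apply: (allP (order_path_min ltn_trans path_s)).
    by rewrite eq_s mem_cat min_s0.
  (* Since [x] is positive, 1 + [x.-1] is [x]. *)
  apply: leq_trans le_x; rewrite card_fseq (leq_trans (size_undup _)) //=; lia.
rewrite big_cons -eq_s1 eq_s; apply/fsetP => y; rewrite !inE.
exact: orbA.
Qed.

(* Exchange argument: if the least element [x] belongs to some [G] but not to
   [A], then it can be swapped with an element of [A] that is larger than [x]. *)
Lemma greedy_complete (k r i : nat) (s : seq nat) (A : {fset nat})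
    (Gs : seq {fset nat}) :
  path ltn i s -> (#|` A| <= r)%N -> (size Gs <= k)%N ->
  (forall G x, G \in Gs -> x \in G -> (#|` G| <= x)%N) ->
  (forall x, x \in s -> x \in A \/ exists2 G, G \in Gs & x \in G) ->
  greedy k r s.
Proof.
elim: s k r i A Gs => // x s IH k r i A Gs /= /andP[lt_ix path_s].
have gt_x y : y \in s -> (x < y)%N.
  exact: (allP (order_path_min ltn_trans path_s)).
case: r => [|r] le_A le_Gs schr cover; last first.
  have remA a : a \in A -> (#|` A `\ a| <= r)%N.
    by move=> aA; move: le_A; rewrite (cardfsD1 a A) aA add1n ltnS.
  have drop a : a \in A -> (a <= x)%N -> greedy k r s.
    move=> aA le_ax; apply: (IH _ _ x (A `\ a) Gs) => // [|y ys]; first exact: remA.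
    case: (cover y); rewrite ?inE ?ys ?orbT //; last by right.
    by move=> yA; left; rewrite yA gtn_eqF ?(leq_ltn_trans le_ax) ?gt_x.
  have [xA|[G GGs xG]] := cover x (mem_head _ _); first exact: (drop x).
  have [A0|[a aA]] := fset_0Vmem A.
    apply: (IH _ _ x A Gs) => // [|y ys]; first by rewrite A0 cardfs0.
    by apply: cover; rewrite inE ys orbT.
  have [le_ax|lt_xa] := leqP a x; first exact: (drop a).
  have GsP H : H \in Gs -> H = G \/ H \in rem G Gs.
    by rewrite (perm_mem (perm_to_rem GGs)) inE => /orP[/eqP|]; [left|right].
  (* Trading [x] for the larger [a] does not enlarge [G] or lower its minimum. *)
  apply: (IH _ _ x (A `\ a) ((a |` (G `\ x)) :: rem G Gs)) => //.
  - exact: remA.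
  - by rewrite /= size_rem // prednK //; case: (Gs) GGs.
  - move=> H y; rewrite inE => /orP[/eqP->|/mem_rem HGs yH]; last exact: schr yH.
    have le_H : (#|` a |` (G `\ x)| <= #|` G|)%N.
      by rewrite (cardfsD1 x G) xG cardfsU1 leq_add2r leq_b1.
    move=> yH; apply: leq_trans le_H _.
    move: yH; rewrite !inE => /orP[/eqP->|/andP[_ yG]]; last exact: schr yG.
    by rewrite (leq_trans (schr _ _ GGs xG)) // ltnW.
  - move=> y ys; have [->|neq_ya] := eqVneq y a.
      by right; exists (a |` (G `\ x)); rewrite ?mem_head // !inE eqxx.
    case: (cover y); rewrite ?inE ?ys ?orbT //.
      by move=> yA; left; rewrite yA andbT.
    move=> [H /GsP[->|HGs] yH]; right.
      exists (a |` (G `\ x)); rewrite ?mem_head // !inE yH andbT.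
      by rewrite (gtn_eqF (gt_x _ ys)) orbT.
    by exists H; rewrite // inE HGs orbT.
have A0 : A = fset0 by apply: cardfs0_eq; apply/eqP; rewrite -leqn0.
have [|[G GGs xG]] := cover x (mem_head _ _); first by rewrite A0 inE.
have size_Gs : size Gs = (size (rem G Gs)).+1.
  by rewrite size_rem // prednK //; case: (Gs) GGs.
case: k le_Gs => [|k]; rewrite size_Gs // ltnS => le_rem.
(* [G] becomes the current set; its at most [x.-1] other elements fit. *)
apply: (IH _ _ x (G `\ x) (rem G Gs)) => //.
- have := schr _ _ GGs xG; rewrite (cardfsD1 x G) xG; lia.
- by move=> H y /mem_rem; apply: schr.
move=> y ys; case: (cover y); rewrite ?inE ?ys ?orbT ?A0 //.
move=> [H]; rewrite (perm_mem (perm_to_rem GGs)) inE => /orP[/eqP->|HGs] yH.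
  by left; rewrite yH (gtn_eqF (gt_x _ ys)).
by right; exists H.
Qed.

Lemma kS_sort (k : nat) (F : {fset nat}) : kS k F ->
  path ltn 0 (sort leq F) /\ greedy k 0 (sort leq F).
Proof.
move=> [Gs [le_Gs schr eq_F]].
have schr_le G x : G \in Gs -> x \in G -> (#|` G| <= x)%N.
  by move=> /schr[neq0 le_G] xG; apply: leq_trans le_G _; apply: (fminP neq0).2.
have cover x : x \in F -> exists2 G, G \in Gs & x \in G.
  by rewrite eq_F => /bigfcupP[G /andP[]]; exists G.
have path_F : path ltn 0 (sort leq F).
  rewrite (path_sortedE ltn_trans) ltn_sorted_uniq_leq sort_uniq fset_uniq.
  rewrite (sort_sorted leq_total) !andbT; apply/allP => x; rewrite mem_sort.
  move=> /cover[G GGs xG]; have := schr_le _ _ GGs xG.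
  by apply: leq_trans; rewrite cardfs_gt0; apply/fset0Pn; exists x.
split=> //; apply: (@greedy_complete _ _ _ _ fset0 _ path_F _ le_Gs schr_le).
  by rewrite cardfs0.
by move=> x; rewrite mem_sort => /cover; right.
Qed.

Lemma fmax_path (s : seq nat) : path ltn 0 s -> fmax [fset x in s] = last 0%N s.
Proof.
move=> path_s; have uniq_s : uniq s.
  exact: (sorted_uniq ltn_trans ltnn (path_sorted path_s)).
rewrite /fmax (perm_big s) /=; last first.
  by apply: uniq_perm; rewrite ?fset_uniq // => x; rewrite !inE.
rewrite -[LHS]max0n.
have max_last i t : path ltn i t -> maxn i (\max_(x <- t) x) = last i t.
  elim: t i => [|x t IH] i /=; first by rewrite big_nil maxn0.
  move=> /andP[lt_ix /IH <-]; rewrite big_cons maxnA; congr maxn.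
  exact/maxn_idPr/ltnW.
exact: max_last.
Qed.

(** Sorting is a bijection from [kS_max k n] onto the accepted lists. *)
Lemma schreier_countE (k n : nat) : (0 < n)%N ->
  (schreier_count k n)%:Z = N k 0 0 n.
Proof.
move=> n0; congr Posz; rewrite -size_filter /schreier_count.
set L := filter _ _.
have LP s : s \in L = [&& greedy k 0 s, path ltn 0 s & last 0%N s == n].
  by rewrite mem_filter mem_increasing add0n subn1 prednK.
have -> : fset_set (kS_max k n) = [fset [fset x in (s : seq nat)] | s in L].
  apply/fsetP => F; apply/idP/imfsetP => [|[s /= sL ->]].
    rewrite in_fset_set ?inE; last exact: kS_max_finite.
    case=> /kS_sort[path_F greedy_F] max_F.
    have eq_F : F = [fset x in sort leq F].
      by apply/fsetP => x; rewrite !inE mem_sort.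
    exists (sort leq F) => //=; rewrite LP greedy_F path_F /=.
    by rewrite -fmax_path // -eq_F max_F.
  rewrite in_fset_set ?inE; last exact: kS_max_finite.
  move: sL; rewrite LP => /and3P[greedy_s path_s /eqP last_s].
  split; last by rewrite fmax_path.
  have [s0 [s1 [-> le_s0 kS_s1]]] := greedy_kS path_s greedy_s.
  by move: le_s0 kS_s1; rewrite leqn0 size_eq0 => /eqP->.
rewrite card_in_imfset /=; first by rewrite undup_id // filter_uniq // increasing_uniq.
move=> s t; rewrite !LP => /and3P[_ path_s _] /and3P[_ path_t _] /fsetP eq_st.
apply: (irr_sorted_eq ltn_trans ltnn (path_sorted path_s) (path_sorted path_t)).
by move=> x; have := eq_st x; rewrite !inE.
Qed.

Theorem theorem1 (k : nat) (hk : (0 < k)%N) :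
  linear_recurrence (schreier_poly k) (fun n : nat => (schreier_count k n)%:Z).
Proof.
split; first by rewrite -size_poly_eq0 size_schreier_poly.
move=> n n0; rewrite -[LHS]/(shift_poly _ (fun n => (schreier_count k n)%:Z) n).
(* As p_k = Q_k - 1, the recurrence says that Q_k(E) fixes the sequence. *)
rewrite schreier_poly_iter shift_polyD.
rewrite -scaleN1r shift_polyZ shift_poly1 mulN1r shift_poly_iter.
rewrite (@shift_iter_eq _ _ (N k 0 0)) => [|m lt_nm]; last first.
  by rewrite schreier_countE // (ltn_trans n0).
by rewrite shift_N_start // schreier_countE // subrr.
Qed.
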